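(* Let $p\ge 2$, and for every $i\in[p]$ let $n_i,t_i,s_i$ be positive integers satisfying $n_i\ge s_i+t_i+1$ and $2\le s_i,t_i\le\frac{n_i}{2}$; suppose also that $n_i\le\frac{7}{4}n_j$ for all distinct $i,j\in[p]$. If $\prod_{i\in[p]}\binom{n_i}{s_i}\ge\prod_{i\in[p]}\binom{n_i}{t_i}$ and $\mathcal{A}\subseteq\prod_{i\in[p]}\binom{[n_i]}{t_i}$, $\mathcal{B}\subseteq\prod_{i\in[p]}\binom{[n_i]}{s_i}$ are non-empty cross-intersecting families, then $$|\mathcal{A}|+|\mathcal{B}|\le\prod_{i\in[p]}\binom{n_i}{s_i}-\prod_{i\in[p]}\binom{n_i-t_i}{s_i}+1,$$ and the bound is attained if and only if one of the following holds: (i) $\prod_{i\in[p]}\binom{n_i}{s_i}\ge\prod_{i\in[p]}\binom{n_i}{t_i}$, $\mathcal{A}=\{A\}$ and $\mathcal{B}=\{B\in\prod_{i\in[p]}\binom{[n_i]}{s_i}: B\cap A\ne\emptyset\}$ for some $A\in\prod_{i\in[p]}\binom{[n_i]}{t_i}$; (ii) $\prod_{i\in[p]}\binom{n_i}{s_i}=\prod_{i\in[p]}\binom{n_i}{t_i}$, $\mathcal{B}=\{B\}$ and $\mathcal{A}=\{A\in\prod_{i\in[p]}\binom{[n_i]}{t_i}: B\cap A\ne\emptyset\}$ for some $B\in\prod_{i\in[p]}\binom{[n_i]}{s_i}$.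
   Context: $[n]=\{1,\ldots,n\}$, and $\binom{[n]}{k}$ is the family of all $k$-element subsets of $[n]$. Multi-part families: the ground set is a disjoint union of $p$ parts, the $i$-th part being a copy of $[n_i]$. $\prod_{i\in[p]}\binom{[n_i]}{k_i}$ denotes the family of all subsets $A=\bigsqcup_{i\in[p]}A_i$ of this ground set having exactly $k_i$ elements in the $i$-th part for each $i$ (so $A_i\in\binom{[n_i]}{k_i}$). Hence $A\cap B\ne\emptyset$ means $A_i\cap B_i\ne\emptyset$ for at least one $i\in[p]$. Two families $\mathcal{A},\mathcal{B}$ are cross-intersecting if $A\cap B\ne\emptyset$ for all $A\in\mathcal{A}$, $B\in\mathcal{B}$. *)

(* Defs.v *)
From HB Require Import structures.
From mathcomp Require Import all_boot.

Set Implicit Arguments.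
Unset Strict Implicit.
Unset Printing Implicit Defensive.

(* The disjoint union of the p parts; the i-th part [n_i] is modelled by the
   ordinal type 'I_(n i), i.e. by {0, ..., n_i - 1}. *)
Notation ground n := {i : 'I__ & 'I_(n i)}.

Section MultiPart.
Variables (p : nat) (n : 'I_p -> nat).

(* The component A_i of A, as a subset of [n_i]. *)
Definition part (A : {set ground n}) (i : 'I_p) : {set 'I_(n i)} :=
  [set x | Tagged (fun j => 'I_(n j)) x \in A].

Definition multipart_family (k : 'I_p -> nat) : {set {set ground n}} :=
  [set A | [forall i, #|part A i| == k i]].

End MultiPart.

Definition cross_intersecting (T : finType) (FA FB : {set {set T}}) : Prop :=
  forall A B : {set T}, A \in FA -> B \in FB -> A :&: B != set0.

(* Main.v *)
Require Import Defs.
From HB Require Import structures.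
From mathcomp Require Import all_boot fingroup perm zify.

Set Implicit Arguments.
Unset Strict Implicit.
Unset Printing Implicit Defensive.

(** Work with a finite ground set T labelled by lab : T -> I; the i-th part is
    the fiber of i, of size n i, and [layer k] is the family of sets with k i
    points in every part. Call a pair (A, B) of non-empty cross-intersecting
    families, A in [layer t] and B in [layer s], optimal when |A| + |B| is
    maximal. Everything follows from one fact, [optimal_smaller_single]: in an
    optimal pair the smaller family has one member. By maximality the other
    family then consists of all the sets that meet this member, and comparing
    the two possible values of the sum gives the bound and its equality cases.

    The reason is symmetry together with uncrossing. If (A, B) and (A', B') are
    cross-intersecting, then so are (A :&: A', B :|: B') and
    (A :|: A', B :&: B'), and the four cardinals add up to the original ones.
    So if both pairs are optimal and the new ones have no empty member, the new
    ones are optimal as well; when |A| <= |B| it suffices that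
    A :&: A' is not empty ([optimal_uncross]). Take A' and B' to be the images
    of A and B under the exchange of two points u, v of the same part, and let
    A be as small as possible among the smaller sides with at least two
    members. Then A meets its image in nothing, in a single set, or is
    invariant.

    A single common set a is impossible ([swap_not_meets_once]): it forces every
    other member of A to arise from a by replacing u or v by a point outside a,
    so A has at most n i - t i + 1 members, while the sets disjoint from some
    member of A are too numerous.

    So A is a block: each exchange fixes A or moves it off itself. Let S be the
    set of parts in which every exchange fixes A. Off S, two members of A that
    are disjoint from a common set of [layer s] agree ([block_agree]), so A
    looks like full layers over S times essentially isolated points off S. Double counting
    the disjoint pairs bounds below the number of sets that A misses. In an
    optimal pair this number is small ([optimal_expansion]), and when S is
    neither empty nor everything the two bounds contradict each other by the
    inequality [prod_tradeoff], where the hypothesis on the ratios of the part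
    sizes enters. *)

(** * Binomial estimates *)

Lemma bin_pascal m k : 0 < m -> 0 < k -> 'C(m, k) = 'C(m.-1, k) + 'C(m.-1, k.-1).
Proof. by case: m k => [|m] [|k] // _ _; rewrite binS. Qed.

Lemma leq_bin_self m k : 0 < k < m -> m <= 'C(m, k).
Proof.
elim: m k => [|m IH] [|k] //; rewrite ltnS => /= km; rewrite binS.
case: k km => [|k] km; first by rewrite bin0 bin1 addn1.
have [ekm | nkm] := eqVneq k.+2 m; first by rewrite ekm binn add1n ltnS IH; lia.
have h1 : m <= 'C(m, k.+2) by apply: IH; lia.
have h2 : m <= 'C(m, k.+1) by apply: IH; lia.
lia.
Qed.

(** Avoiding t >= 2 points is at least as hard as avoiding two of them, and for
    two points the ratio of the binomials is explicit. *)
Lemma bin_avoid_two n t s : 2 <= t -> 2 <= n ->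
  n * n.-1 * 'C(n - t, s) <= (n - s) * (n - s - 1) * 'C(n, s).
Proof.
move=> t2 n2; apply: (@leq_trans (n * n.-1 * 'C(n.-1.-1, s))).
  by rewrite leq_mul2l leq_bin2l ?orbT //; lia.
have h1 := mul_bin_down n s; have h2 := mul_bin_down n.-1 s.
rewrite -mulnA h2 mulnCA h1 mulnCA mulnA.
by rewrite leq_mul2r; apply/orP; right; rewrite leq_mul //; lia.
Qed.

(** For t, s >= 2 a random s-set meets a fixed t-set with probability at least
    (4n - 6) / (n (n - 1)), and e >= 2n / 7; the product of the two bounds is at
    least 1 as soon as n >= 5, which is implied by s + t < n. *)
Lemma bin_tradeoff n m t s e : 2 <= t -> 2 <= s -> s + t < n ->
  4 * n <= 7 * m -> m <= 2 * e ->
  'C(n, s) + e * 'C(n - t, s) <= e * 'C(n, s).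
Proof.
move=> t2 s2 stn nm me.
have avoid : n * n.-1 * 'C(n - t, s) <= (n - 2) * (n - 3) * 'C(n, s).
  apply: leq_trans (bin_avoid_two s t2 _) _; first by lia.
  by rewrite leq_mul2r leq_mul ?orbT //; lia.
have ne : 2 * n <= 7 * e by lia.
have n5 : 5 <= n by lia.
move: {nm me stn t2} ('C(n, s)) ('C(n - t, s)) avoid => K D.
case: n ne n5 => [|[|[|[|[|n]]]]] // ne _.
rewrite !subSS !subn0 /= => avoid.
rewrite -(@leq_pmul2l (n.+4.+1 * n.+4)) //.
have k1 : n.+4.+1 * n.+4 <= e * (4 * n + 14) by nia.
have k2 := leq_mul (leqnn e) avoid; have k3 := leq_mul k1 (leqnn K).
nia.
Qed.

(** Both sides count the pairs of disjoint sets of sizes t and s. *)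
Lemma bin_disjointC n t s : s + t <= n ->
  'C(n - t, s) * 'C(n, t) = 'C(n - s, t) * 'C(n, s).
Proof.
move=> stn; have tn : t <= n by lia. have sn : s <= n by lia.
have snt : s <= n - t by lia. have tns : t <= n - s by lia.
have ht := bin_fact tn; have hs := bin_fact sn.
have hst := bin_fact snt; have hts := bin_fact tns.
have e : n - t - s = n - s - t by lia.
apply/eqP; rewrite -(@eqn_pmul2r (t`! * s`! * (n - t - s)`!)) ?muln_gt0 ?fact_gt0 //.
apply/eqP; transitivity n`!; last rewrite -hs -hts e; rewrite -?ht -?hst; nia.
Qed.


(** * Layers of a labelled set *)
Section LabelledGroundSet.
Variables (I T : finType) (lab : T -> I).
Implicit Types (a b c Z : {set T}) (u v w : T) (i j : I) (k t s : I -> nat).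
Implicit Types (A B F : {set {set T}}).

Definition fiber i : {set T} := [set w | lab w == i].

Definition layer k : {set {set T}} := [set a | [forall i, #|a :&: fiber i| == k i]].

Lemma layerP k a : reflect (forall i, #|a :&: fiber i| = k i) (a \in layer k).
Proof. by rewrite inE; apply: (iffP forallP) => h i; apply/eqP; apply: h. Qed.

Lemma mem_fiber w : w \in fiber (lab w).
Proof. by rewrite inE. Qed.

(** A member of the layer is the same as an independent choice, in each part,
    of k i points outside Z. *)
Lemma card_layer_avoiding k Z :
  #|[set a in layer k | a :&: Z == set0]| = \prod_i 'C(#|fiber i :\: Z|, k i).
Proof.
pose slices a : {ffun I -> {set T}} := [ffun i => a :&: fiber i].
pose P i := [set C : {set T} | C \subset fiber i :\: Z & #|C| == k i].
have slices_inj : injective slices.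
  move=> a b eab; apply/setP=> w.
  have /setP/(_ w) := congr1 (fun f : {ffun I -> {set T}} => f (lab w)) eab.
  by rewrite !ffunE !inE eqxx !andbT.
rewrite -(card_imset _ slices_inj).
have -> : #|slices @: [set a in layer k | a :&: Z == set0]| =
          #|(family (fun i => mem (P i)) : simpl_pred {ffun I -> {set T}})|.
  apply: eq_card => f; apply/imsetP/familyP => [[a] | fP].
    rewrite inE => /andP[/layerP ka /eqP aZ] -> i; rewrite ffunE inE ka eqxx andbT.
    apply/subsetP=> w; rewrite !inE => /andP[wa ->]; rewrite andbT.
    by apply/negP=> wZ; move/setP/(_ w): aZ; rewrite !inE wa wZ.
  have fsub i w : w \in f i -> w \notin Z /\ lab w = i.
    have := fP i; rewrite inE => /andP[/subsetP sub _] /sub.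
    by rewrite !inE => /andP[-> /eqP].
  have fE i : [set w | w \in f (lab w)] :&: fiber i = f i.
    apply/setP=> w; rewrite !inE; apply/andP/idP => [[wf /eqP <-//] | wf].
    by have [_ ->] := fsub _ _ wf.
  exists [set w | w \in f (lab w)]; last by apply/ffunP=> i; rewrite ffunE fE.
  rewrite inE; apply/andP; split.
    by apply/layerP=> i; rewrite fE; have := fP i; rewrite inE => /andP[_ /eqP].
  apply/eqP/setP=> w; rewrite !inE; apply/negP=> /andP[/fsub[/negP wZ _]].
  exact: wZ.
rewrite card_family foldrE big_map big_enum /=.
by apply: eq_bigr => i _; rewrite -cards_draws; apply: eq_card => C; rewrite !inE.
Qed.

Lemma card_layer k : #|layer k| = \prod_i 'C(#|fiber i|, k i).
Proof.
under eq_bigr do rewrite -[fiber _]setD0.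
rewrite -card_layer_avoiding; apply: eq_card => a.
by rewrite !inE setI0 eqxx andbT.
Qed.

Lemma card_fiberD a i : #|fiber i :\: a| = #|fiber i| - #|a :&: fiber i|.
Proof. by rewrite cardsD setIC. Qed.

Lemma card_layer_disjoint k l a : a \in layer l ->
  #|[set c in layer k | c :&: a == set0]| = \prod_i 'C(#|fiber i| - l i, k i).
Proof.
move=> /layerP al; rewrite card_layer_avoiding.
by apply: eq_bigr => i _; rewrite card_fiberD al.
Qed.

Lemma card_layer_meeting k l a : a \in layer l ->
  #|[set c in layer k | c :&: a != set0]| + \prod_i 'C(#|fiber i| - l i, k i) = 
  \prod_i 'C(#|fiber i|, k i).
Proof.
move=> al; rewrite -(card_layer_disjoint k al) -card_layer.
rewrite addnC -(cardsID [set c | c :&: a == set0] (layer k)); congr addn.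
  by apply: eq_card => c; rewrite !inE.
by apply: eq_card => c; rewrite !inE andbC.
Qed.

(** * Exchanging two points *)

(** An exchange is its own inverse, so that preimages compute images and
    membership unfolds without existentials. *)
Definition swap u v a : {set T} := tperm u v @^-1: a.
Definition swapF u v (F : {set {set T}}) : {set {set T}} := swap u v @^-1: F.

Lemma mem_swap u v a w : (w \in swap u v a) = (tperm u v w \in a).
Proof. by rewrite inE. Qed.

Lemma mem_swapF u v F a : (a \in swapF u v F) = (swap u v a \in F).
Proof. by rewrite inE. Qed.

Lemma swapK u v : involutive (swap u v).
Proof. by move=> a; apply/setP=> w; rewrite !mem_swap tpermK. Qed.

Lemma swapFK u v : involutive (swapF u v).
Proof. by move=> F; apply/setP=> a; rewrite !mem_swapF swapK. Qed.

Lemma swapC u v : swap u v =1 swap v u.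
Proof. by move=> a; rewrite /swap tpermC. Qed.

Lemma card_swapF u v F : #|swapF u v F| = #|F|.
Proof. exact: card_preimset (inv_inj (swapK u v)). Qed.

Lemma swap_id u v a : (u \in a) = (v \in a) -> swap u v a = a.
Proof.
by move=> uva; apply/setP=> w; rewrite mem_swap; case: tpermP => [->|->|].
Qed.

Lemma swap_setI0 u v a b : (swap u v a :&: b == set0) = (a :&: swap u v b == set0).
Proof.
rewrite -{1}[b](swapK u v) -preimsetI -!cards_eq0 card_preimset //.
exact: perm_inj.
Qed.

Lemma swap_layer u v k a : lab u = lab v -> (swap u v a \in layer k) = (a \in layer k).
Proof.
move=> luv; rewrite !inE; apply: eq_forallb => i.
have -> : swap u v a :&: fiber i = tperm u v @^-1: (a :&: fiber i).
  by apply/setP=> w; rewrite !inE; case: tpermP => // ->; rewrite luv.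
by rewrite card_preimset //; exact: perm_inj.
Qed.

(** Any member avoiding Z passes through w after the exchange of w with one of
    its points in the part of w. *)
Lemma layer_avoiding_through k Z w : (forall i, k i <= #|fiber i :\: Z|) ->
  0 < k (lab w) -> w \notin Z ->
  exists2 c, c \in layer k & c :&: Z = set0 /\ w \in c.
Proof.
move=> kZ kw wZ.
have : 0 < #|[set c in layer k | c :&: Z == set0]|.
  by rewrite card_layer_avoiding prodn_cond_gt0 // => i _; rewrite bin_gt0.
case/card_gt0P=> c; rewrite inE => /andP[ck /eqP cZ].
have : 0 < #|c :&: fiber (lab w)| by rewrite (layerP _ _ ck).
case/card_gt0P=> w'; rewrite !inE => /andP[w'c /eqP lw'].
have w'Z : w' \notin Z by apply/negP=> w'Z; move/setP/(_ w'): cZ; rewrite !inE w'c w'Z.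
exists (swap w w' c); first by rewrite swap_layer.
split; last by rewrite mem_swap tpermL.
apply/eqP; rewrite swap_setI0 swap_id ?cZ //.
by rewrite (negbTE wZ) (negbTE w'Z).
Qed.

(** * Optimal cross-intersecting pairs *)
Local Notation n i := #|fiber i|.
Local Notation deg t s := (\prod_i 'C(n i - t i, s i)).

Definition crossing t s A B :=
  [/\ A \subset layer t, B \subset layer s, A != set0, B != set0
    & cross_intersecting A B].

Definition optimal t s A B :=
  crossing t s A B /\
  forall A' B', crossing t s A' B' -> #|A'| + #|B'| <= #|A| + #|B|.

Definition admissible t s := forall i,
  [/\ 2 <= t i, 2 <= s i, 2 * t i <= n i, 2 * s i <= n i & s i + t i < n i].

Lemma admissibleC t s : admissible t s -> admissible s t.
Proof. by move=> ts i; have [] := ts i; split=> //; rewrite addnC. Qed.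

Lemma crossingC t s A B : crossing t s A B -> crossing s t B A.
Proof.
by case=> At Bs A0 B0 AB; split=> // b a bB aA; rewrite setIC; apply: AB.
Qed.

Lemma optimalC t s A B : optimal t s A B -> optimal s t B A.
Proof.
case=> AB max; split=> [|B' A' BA]; first exact: crossingC.
by rewrite addnC [leqRHS]addnC; apply/max/crossingC.
Qed.

Lemma crossing_swap u v t s A B : lab u = lab v ->
  crossing t s A B -> crossing t s (swapF u v A) (swapF u v B).
Proof.
move=> luv [/subsetP At /subsetP Bs A0 B0 AB]; split.
- by apply/subsetP=> a; rewrite mem_swapF => /At; rewrite swap_layer.
- by apply/subsetP=> a; rewrite mem_swapF => /Bs; rewrite swap_layer.
- by rewrite -card_gt0 card_swapF card_gt0.
- by rewrite -card_gt0 card_swapF card_gt0.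
move=> a b; rewrite !mem_swapF => aA bB.
by have := AB _ _ aA bB; rewrite swap_setI0 swapK.
Qed.

Lemma optimal_swap u v t s A B : lab u = lab v ->
  optimal t s A B -> optimal t s (swapF u v A) (swapF u v B).
Proof.
move=> luv [AB max]; split; first exact: crossing_swap.
by move=> A' B'; rewrite !card_swapF; apply: max.
Qed.

Lemma crossing_IU t s A B A' B' : crossing t s A B -> crossing t s A' B' ->
  A :&: A' != set0 -> crossing t s (A :&: A') (B :|: B').
Proof.
move=> [At Bs A0 /set0Pn[b bB] AB] [At' Bs' A0' B0' AB'] AA'; split=> //.
- by rewrite subIset ?At.
- by rewrite subUset Bs.
- by apply/set0Pn; exists b; rewrite inE bB.
by move=> a c; rewrite !inE => /andP[aA aA'] /orP[]; [apply: AB | apply: AB'].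
Qed.

(** The condition |A| <= |B| makes B :&: B' non-empty: optimality bounds
    |B :|: B'| by |A| + |B| - |A :&: A'| < |B| + |B'|. *)
Lemma optimal_uncross t s A B A' B' : optimal t s A B -> optimal t s A' B' ->
  #|A'| <= #|A| -> #|B| <= #|B'| -> #|A| <= #|B| ->
  A :&: A' != set0 -> optimal t s (A :&: A') (B :|: B').
Proof.
move=> [AB max] [AB' max'] cA cB cAB AA'.
have IU := crossing_IU AB AB' AA'; have leIU := max _ _ IU.
have eM : #|A'| + #|B'| = #|A| + #|B|.
  by apply/eqP; rewrite eqn_leq max' // max.
have cardA := cardsUI A A'; have cardB := cardsUI B B'.
have AA'0 : 0 < #|A :&: A'| by rewrite card_gt0.
have BB' : B :&: B' != set0 by rewrite -card_gt0; lia.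
have UI : crossing t s (A :|: A') (B :&: B').
  by rewrite setUC setIC; apply/crossingC/crossing_IU; rewrite 1?setIC //; exact: crossingC.
have leUI := max _ _ UI.
by split=> // A1 B1 /max; lia.
Qed.

(** The neighbourhood of A in the bipartite graph of disjoint pairs. *)
Definition missed s A := [set c in layer s | [exists a in A, c :&: a == set0]].

Lemma missedP s A c : reflect (c \in layer s /\ exists2 a, a \in A & c :&: a = set0)
  (c \in missed s A).
Proof.
apply: (iffP setIdP) => -[cs].
  by case/exists_inP=> a aA /eqP; split=> //; exists a.
by case=> a aA /eqP ca; split=> //; apply/exists_inP; exists a.
Qed.

Lemma card_missed t s A B : crossing t s A B -> #|missed s A| + #|B| <= #|layer s|.
Proof.
case=> _ /subsetP Bs _ _ AB; have dis : missed s A :&: B = set0.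
  apply/setP=> c; rewrite in_setI in_set0; apply/negP=> /andP[/missedP[_ [a aA ca]] cB].
  by have := AB _ _ aA cB; rewrite setIC ca eqxx.
rewrite -cardsUI dis cards0 addn0; apply/subset_leq_card/subsetP=> c.
by rewrite inE => /orP[/missedP[] | /Bs].
Qed.

(** Compare with the pair formed by one set and all the sets that meet it. *)
Lemma optimal_ge_star t s A B : optimal t s A B ->
  #|layer s| + 1 <= #|A| + #|B| + deg t s.
Proof.
case=> -[/subsetP At /subsetP Bs /set0Pn[a aA] /set0Pn[b bB] AB] max.
have al := At _ aA.
have := card_layer_meeting s al; rewrite -card_layer => <-.
have /max : crossing t s [set a] [set c in layer s | c :&: a != set0].
  split; rewrite ?sub1set //.
  - by apply/subsetP=> c; rewrite inE => /andP[].
  - by apply/set0Pn; exists a; rewrite inE.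
  - by apply/set0Pn; exists b; rewrite inE Bs // setIC AB.
  by move=> c d /set1P ->; rewrite inE setIC => /andP[].
by rewrite cards1; lia.
Qed.

Lemma layer_gt0 t s : admissible t s -> 0 < #|layer t|.
Proof.
move=> ts; rewrite card_layer prodn_cond_gt0 // => i _.
by rewrite bin_gt0; case: (ts i); lia.
Qed.

Lemma deg_double_count t s : admissible t s ->
  deg t s * #|layer t| = deg s t * #|layer s|.
Proof.
move=> ts; rewrite !card_layer -!big_split /=; apply: eq_bigr => i _.
by apply: bin_disjointC; case: (ts i); lia.
Qed.

(** The densities satisfy |missed A| / |layer s| < |A| / |layer t| + p, where p is
    the probability that two random sets of the two layers are disjoint. The
    larger of the two layers decides which of the two stars is the one to
    compare with; the resulting inequality is the same, which keeps the later
    arguments symmetric in t and s. *)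
Lemma optimal_expansion t s A B : admissible t s -> optimal t s A B ->
  #|missed s A| * #|layer t| < #|A| * #|layer s| + deg t s * #|layer t|.
Proof.
move=> ts oAB; have miss := card_missed oAB.1.
have M1 := optimal_ge_star oAB; have M2 := optimal_ge_star (optimalC oAB).
have x0 := layer_gt0 ts; have y0 := layer_gt0 (admissibleC ts).
have dd := deg_double_count ts.
move: miss M1 M2 x0 y0 dd.
move: (deg t s) (deg s t) #|layer t| #|layer s| #|missed s A| #|A| #|B|.
move=> d e x y N a b miss M1 M2 x0 y0 dd.
have [xy | /ltnW yx] := leqP x y.
  (* Here the star centred in layer t gives the bound. *)
  have N1 : N + 1 <= a + d by lia.
  nia.
(* Here it is the star centred in layer s. *)
have Ny : N <= y by lia.
have lt_ae : (x - y) + N < a + e by lia.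
rewrite dd -mulnDl; apply: (@leq_trans ((x - y + N).+1 * y)); last by rewrite leq_mul2r lt_ae orbT.
rewrite -[in X in X < _](subnKC yx); move: (x - y) => r.
by rewrite mulSn mulnDr mulnDl addnC; nia.
Qed.

(** One part i0 of S and one part j0 outside S already give the inequality: the
    remaining factors only help. *)
Lemma prod_tradeoff t s (S : {set I}) i0 j0 : admissible t s ->
  4 * n i0 <= 7 * n j0 -> i0 \in S -> j0 \notin S ->
  \prod_(i in S) 'C(n i, s i) +
  \prod_(j in ~: S) 'C(n j - s j, t j) * \prod_(i in S) 'C(n i - t i, s i) <=
  \prod_(j in ~: S) 'C(n j - s j, t j) * \prod_(i in S) 'C(n i, s i).
Proof.
move=> ts ratio iS jS.
have splitE f : \prod_(j in ~: S) f j = f j0 * \prod_(j in ~: S | j != j0) f j.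
  by apply: bigD1; rewrite inE.
have splitS f : \prod_(i in S) f i = f i0 * \prod_(i in S | i != i0) f i.
  exact: bigD1.
rewrite splitE !splitS {splitE splitS}.
have e'0 : 0 < \prod_(j in ~: S | j != j0) 'C(n j - s j, t j).
  by rewrite prodn_cond_gt0 // => i _; rewrite bin_gt0; case: (ts i); lia.
have dk : \prod_(i in S | i != i0) 'C(n i - t i, s i) <=
          \prod_(i in S | i != i0) 'C(n i, s i).
  by apply: leq_prod => i _; rewrite leq_bin2l // leq_subr.
have : 'C(n i0, s i0) + 'C(n j0 - s j0, t j0) * 'C(n i0 - t i0, s i0)
       <= 'C(n j0 - s j0, t j0) * 'C(n i0, s i0).
  have [? ? ? ? ?] := ts i0; have [? ? ? ? ?] := ts j0.
  apply: (@bin_tradeoff _ (n j0)) => //.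
  by have := @leq_bin_self (n j0 - s j0) (t j0); lia.
move: e'0 dk; move: (\prod_(j in ~: S | _) _) (\prod_(i in S | _) _) (\prod_(i in S | _) _).
move: ('C(_, _)) ('C(_, _)) ('C(_, _)) => D e K e' k d e'0 dk eKD.
have h1 := leq_mul (leqnn (e' * k)) eKD.
have h2 := leq_mul (leqnn (e * e' * D)) dk.
have h3 : K * k <= e' * k * K by rewrite mulnC -mulnA leq_pmull.
lia.
Qed.

(** * Blocks *)
Definition swappable A u v := forall a, a \in A -> swap u v a \in A.

(** The exchange of u and w is the conjugate of that of v and w by that of u
    and v. *)
Lemma swappable_trans A v u w :
  swappable A u v -> swappable A v w -> swappable A u w.
Proof.
move=> uv vw a aA.
have [<-|uw] := eqVneq u w; first by rewrite swap_id.
have [<-|nvw] := eqVneq v w; first exact: uv.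
suff -> : swap u w a = swap u v (swap v w (swap u v a)) by apply/uv/vw/uv.
apply/setP=> x; rewrite !mem_swap; congr (_ \in a).
have -> : tperm u w = (tperm v w ^ tperm u v)%g by rewrite tpermJ tpermR tpermD.
by rewrite /conjg !permM tpermV.
Qed.

(** Blocks of imprimitivity, tested only on the exchanges that generate the
    group of label-preserving permutations. *)
Definition block A := forall u v, lab u = lab v ->
  swapF u v A = A \/ A :&: swapF u v A = set0.

Definition free_parts A := [set i | [forall u in fiber i, forall v in fiber i,
  swapF u v A == A]].

(** Such an exchange fixes a, so A meets its image. *)
Lemma block_swappable A a u v : block A -> a \in A -> lab u = lab v ->
  (u \in a) = (v \in a) -> swappable A u v.
Proof.
move=> bA aA luv uva b bA'; have [<-|/setP/(_ a)] := bA _ _ luv.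
  by rewrite mem_swapF swapK.
by rewrite !inE swap_id ?aA.
Qed.

Lemma swappable_free A u v : lab u = lab v -> lab u \in free_parts A ->
  swappable A u v.
Proof.
move=> luv; rewrite inE => /forall_inP/(_ u); rewrite mem_fiber.
move=> /(_ isT)/forall_inP/(_ v); rewrite inE luv eqxx => /(_ isT)/eqP e a aA.
by rewrite -e mem_swapF swapK.
Qed.

(** In the i-th part, two points both in a or both outside a may be exchanged,
    and the same holds for b. A point x of a outside b can then be
    exchanged, thanks to b, with a point w of c, which lies outside a; since
    being exchangeable is transitive, all points of the part are exchangeable
    and the part is free. *)
Lemma block_agree A a b c i : block A -> a \in A -> b \in A ->
  c :&: a = set0 -> c :&: b = set0 -> c :&: fiber i != set0 -> i \notin free_parts A ->
  a :&: fiber i \subset b.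
Proof.
move=> bA aA bA' /setP ca /setP cb /set0Pn[w] iw niS.
move: iw; rewrite !inE => /andP[wc /eqP lw].
have wa : w \notin a by apply/negP=> wa; have := ca w; rewrite !inE wc wa.
have wb : w \notin b by apply/negP=> wb; have := cb w; rewrite !inE wc wb.
apply/subsetP=> x; rewrite !inE => /andP[xa /eqP lx]; apply: contraNT niS => xb.
have xw : swappable A x w.
  by apply: (block_swappable bA bA'); rewrite ?lx ?lw // (negbTE xb) (negbTE wb).
have wx : swappable A w x by move=> d /xw; rewrite swapC.
have toa u : lab u = i -> swappable A u w.
  move=> lu; case ua: (u \in a).
    by apply: swappable_trans xw; apply: (block_swappable bA aA); rewrite ?lu ?lx ?ua ?xa.
  by apply: (block_swappable bA aA); rewrite ?lu ?lw ?ua ?(negbTE wa).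
rewrite inE; apply/forall_inP=> u; rewrite inE => /eqP lu.
apply/forall_inP=> v; rewrite inE => /eqP lv.
have uv : swappable A u v.
  apply: (swappable_trans (toa u lu)) => d dA; rewrite swapC; exact: toa.
apply/eqP/setP=> d; rewrite mem_swapF; apply/idP/idP; last exact: uv.
by move/uv; rewrite swapK.
Qed.

(** Count the disjoint pairs (a, c) with a in A. All members of A disjoint from
    c agree outside the free parts, hence are determined by their trace on the
    free parts. *)
Lemma block_double_count t s A : block A -> admissible t s -> A \subset layer t ->
  #|A| * deg t s <= #|missed s A| * \prod_(i in free_parts A) 'C(n i - s i, t i).
Proof.
move=> bA ts /subsetP At; move eS: (free_parts A) => S.
pose N a := [set c in layer s | c :&: a == set0].
have -> : #|A| * deg t s = \sum_(a in A) \sum_(c in missed s A | c :&: a == set0) 1.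
  rewrite -sum_nat_const; apply: eq_bigr => a aA.
  rewrite -(card_layer_disjoint s (At _ aA)) sum1dep_card; apply: eq_card => c.
  rewrite [RHS]inE; apply/setIdP/andP=> -[cs ca]; split=> //; last by case/missedP: cs.
  by apply/missedP; split=> //; exists a => //; apply/eqP.
rewrite (exchange_big_dep (mem (missed s A))) //=; last by move=> a c _ /andP[].
rewrite -sum_nat_const; apply: leq_sum => c /missedP[cs [a0 a0A ca0]].
pose k i := if i \in S then t i else 0.
have -> : \prod_(i in S) 'C(n i - s i, t i) = \prod_i 'C(n i - s i, k i).
  by rewrite big_mkcond; apply: eq_bigr => i _; rewrite /k; case: ifP; rewrite ?bin0.
rewrite -(card_layer_disjoint k cs) sum1dep_card.
pose U := [set w | lab w \in S].
rewrite -(@card_in_imset _ _ (fun a => a :&: U)).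
  apply/subset_leq_card/subsetP=> d /imsetP[a]; rewrite inE => /andP[aA /andP[_ /eqP ca]] ->.
  rewrite inE; apply/andP; split; last first.
    by rewrite setIC setIA ca set0I.
  apply/layerP=> i; rewrite /k; case: ifP => iS; last first.
    apply/eqP; rewrite cards_eq0; apply/eqP/setP=> w; rewrite !inE.
    by apply/negP=> /andP[/andP[_ wS] /eqP lw]; rewrite lw iS in wS.
  rewrite -(layerP _ _ (At _ aA)); congr #|pred_of_set _|; apply/setP=> w; rewrite !inE -andbA.
  by congr andb; case: eqP => [->|]; rewrite ?andbF ?iS.
have part a i : a \in A -> c :&: a = set0 -> i \notin S -> a :&: fiber i = a0 :&: fiber i.
  move=> aA ca iS; have ci : c :&: fiber i != set0.
    by rewrite -card_gt0 (layerP _ _ cs); case: (ts i); lia.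
  apply/eqP; rewrite eqEsubset !subsetI !subsetIr !andbT.
  by rewrite (block_agree bA aA a0A ca ca0 ci) ?eS // (block_agree bA a0A aA ca0 ca ci) ?eS.
move=> a b; rewrite !inE => /and3P[aA _ /eqP ca] /and3P[bA' _ /eqP cb] /setP eab.
apply/setP=> w; have := eab w; rewrite !inE; case wS: (lab w \in S); rewrite ?andbT //.
have h d : d \in A -> c :&: d = set0 -> (w \in d) = (w \in a0).
  move=> dA cd; have /setP/(_ w) := part d (lab w) dA cd (negbT wS).
  by rewrite !inE eqxx !andbT.
by rewrite !h.
Qed.

(** A set c that avoids a on the parts that are not free avoids a member of A:
    inside the free parts, points of a in c can be exchanged one after the other
    with points outside c. *)
Lemma block_missed_ge t s A : admissible t s -> A \subset layer t -> A != set0 ->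
  \prod_(j in ~: free_parts A) 'C(n j - t j, s j) *
  \prod_(i in free_parts A) 'C(n i, s i) <= #|missed s A|.
Proof.
move=> ts /subsetP At /set0Pn[a aA]; move eS: (free_parts A) => S.
pose U := [set w | lab w \in S].
have -> : \prod_(j in ~: S) 'C(n j - t j, s j) * \prod_(i in S) 'C(n i, s i) =
          #|[set c in layer s | c :&: (a :\: U) == set0]|.
  rewrite card_layer_avoiding mulnC [RHS](bigID (mem S)) /=; congr muln.
    apply: eq_bigr => i iS; congr binomial.
    rewrite (_ : fiber i :\: _ = fiber i) //; apply/setP=> w; rewrite !inE.
    by case: eqP => [->|]; rewrite ?andbF // iS.
  under eq_bigl do rewrite inE; apply: eq_bigr => i iS; congr binomial.
  rewrite -(layerP _ _ (At _ aA) i) -card_fiberD; congr #|pred_of_set _|.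
  apply/setP=> w; rewrite !inE.
  by case: eqP => [->|]; rewrite ?andbF // (negbTE iS).
apply/subset_leq_card/subsetP=> c; rewrite inE => /andP[cs /eqP ca].
pose P b := (b \in A) && (b :\: U == a :\: U).
have Pa : P a by rewrite /P aA eqxx.
(* Take b in A with the trace of a off the free parts, meeting c least. *)
have [b /andP[bA /eqP bU] bmin] := arg_minnP (fun b => #|c :&: b|) Pa.
apply/missedP; split=> //; exists b => //; apply/eqP; apply: contraT => /set0Pn[w].
rewrite inE => /andP[wc wb].
have wS : lab w \in S.
  apply: contraT => wS; have : w \in b :\: U by rewrite !inE wb wS.
  by rewrite bU => waU; move/setP/(_ w): ca; rewrite inE wc waU inE.
have : 0 < #|fiber (lab w) :\: (c :|: b)|.
  rewrite card_fiberD subn_gt0 setIUl.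
  apply: leq_ltn_trans (leq_card_setU _ _) _.
  by rewrite (layerP _ _ cs) (layerP _ _ (At _ bA)); case: (ts (lab w)); lia.
case/card_gt0P=> v; rewrite !inE negb_or -andbA => /and3P[vc vb /eqP lv].
have := bmin (swap w v b); rewrite /P swappable_free ?eS //=.
have -> : swap w v b :\: U = b :\: U.
  apply/setP=> x; rewrite !inE; case: tpermP => // ->; rewrite ?lv wS //.
rewrite bU eqxx => /(_ isT); rewrite leqNgt => /negP[].
apply/proper_card/properP; split.
  apply/subsetP=> x; rewrite !inE => /andP[xc]; rewrite xc.
  by case: tpermP => // [->|ex _]; [rewrite (negbTE vb) | rewrite -ex xc in vc].
by exists w; rewrite !inE ?wc ?wb // tpermL (negbTE vb).
Qed.

Lemma prod_avoid_ge t s (P : pred I) i : admissible t s -> P i ->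
  n i - t i <= \prod_(j | P j) 'C(n j - t j, s j).
Proof.
move=> ts Pi; rewrite (bigD1 i) //=.
apply: (@leq_trans 'C(n i - t i, s i)).
  by apply: leq_bin_self; case: (ts i); lia.
rewrite leq_pmulr // prodn_cond_gt0 // => j _; rewrite bin_gt0.
by case: (ts j); lia.
Qed.

(** If no part is free, each set misses at most one member of A, so A misses at
    least deg t s times |A| sets, which is too many; if all parts are free, A misses the
    whole layer and B is empty; otherwise [prod_tradeoff] applies. *)
Lemma block_contradiction t s A B : admissible t s -> I ->
  (forall i j, i != j -> 4 * n i <= 7 * n j) ->
  optimal t s A B -> 1 < #|A| -> block A -> False.
Proof.
move=> ts i0 ratio oAB A2 bA; have [[As Bs A0 B0 _] _] := oAB.
have exp := optimal_expansion ts oAB.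
have dc := block_double_count bA ts As.
have ge := block_missed_ge ts As A0.
have dd := deg_double_count ts.
have y0 := layer_gt0 (admissibleC ts); have x0 := layer_gt0 ts.
set S := free_parts A in dc ge; have [S0 | [i iS]] := set_0Vmem S.
  rewrite S0 big_set0 muln1 in dc.
  have e2 : 1 < deg s t.
    have := prod_avoid_ge (P := xpredT) (admissibleC ts) (isT : xpredT i0).
    by case: (ts i0); lia.
  have h1 := leq_mul dc (leqnn #|layer t|).
  have h2 : #|A| * (deg s t * #|layer s|) < (#|A| + deg s t) * #|layer s|.
    by rewrite -dd mulnA mulnDl -dd; apply: leq_ltn_trans h1 exp.
  by move: h2; rewrite mulnA ltn_mul2r; nia.
have [ST | [j]] := set_0Vmem (~: S).
  have SI : S = setT by rewrite -[S]setCK ST setC0.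
  have eall f : \prod_(j in S) f j = \prod_j f j.
    by rewrite SI; apply: eq_bigl => k; rewrite inE.
  rewrite ST big_set0 mul1n eall -card_layer in ge.
  by have := card_missed oAB.1; move: B0; rewrite -card_gt0; lia.
rewrite in_setC => jS; have ij : i != j by apply: contraNneq jS => <-.
have tr := prod_tradeoff ts (ratio _ _ ij) iS jS.
have split f : \prod_j f j = \prod_(j in S) f j * \prod_(j in ~: S) f j.
  by rewrite (bigID (mem S)); congr muln; apply: eq_bigl => k; rewrite /= ?in_setC.
have pos1 : 0 < \prod_(k in S) 'C(n k, s k).
  by rewrite prodn_cond_gt0 // => k _; rewrite bin_gt0; case: (ts k); lia.
have pos2 : 0 < \prod_(k in ~: S) 'C(n k - s k, t k).
  by rewrite prodn_cond_gt0 // => k _; rewrite bin_gt0; case: (ts k); lia.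
have pos3 : 0 < \prod_(k in S) 'C(n k - s k, t k).
  by rewrite prodn_cond_gt0 // => k _; rewrite bin_gt0; case: (ts k); lia.
rewrite !(split (fun h => 'C(n h - _ h, _ h))) in exp dc dd.
move: exp dc dd ge tr pos1 pos2 pos3.
set N := #|missed s A|; set x := #|layer t|; set y := #|layer s|; set a := #|A|.
set D := \prod_(k in S) 'C(n k - t k, s k).
set D' := \prod_(k in ~: S) 'C(n k - t k, s k).
set E := \prod_(k in S) 'C(n k - s k, t k).
set E' := \prod_(k in ~: S) 'C(n k - s k, t k).
set Y := \prod_(k in S) 'C(n k, s k) => exp dc dd ge tr pos1 pos2 pos3.
have lower : a * E' * y <= N * x.
  rewrite -(leq_pmul2r pos3); have := leq_mul dc (leqnn x).
  by rewrite -[a * _ * x]mulnA dd; nia.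
have := leq_mul (leqnn (N * x)) tr; have := leq_mul lower (leqnn Y).
have := leq_mul ge (leqnn (x * E' * D)).
have : N * x * (E' * Y) < (a * y + D * D' * x) * (E' * Y).
  by rewrite ltn_mul2r muln_gt0 pos1 pos2.
lia.
Qed.

(** * Families meeting their image in a single set *)
Lemma layer_subset_eq t a b : a \in layer t -> b \in layer t -> a \subset b -> a = b.
Proof.
move=> /layerP at_ /layerP bt ab; apply/setP=> w.
have /setP/(_ w) : a :&: fiber (lab w) = b :&: fiber (lab w).
  by apply/eqP; rewrite eqEcard setSI //= at_ bt.
by rewrite !inE eqxx !andbT.
Qed.

(** Otherwise c could be added to B. *)
Lemma optimal_star_full t s a B c : optimal t s [set a] B ->
  c \in layer s -> c :&: a != set0 -> c \in B.
Proof.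
move=> [[at_ Bs a0 B0 aB] max] cs ca; apply: contraT => cB.
have /max : crossing t s [set a] (c |: B).
  split=> //; first by rewrite subUset sub1set cs.
    by apply/set0Pn; exists c; rewrite !inE eqxx.
  move=> d e da; rewrite !inE => /orP[/eqP -> | eB]; last exact: aB.
  by rewrite setIC (set1P da).
by rewrite cardsU1 cB; lia.
Qed.

(** By uncrossing, the pair of [set a] and B :|: swapF u v B is optimal, so every c meeting
    a belongs to B or to its image; it therefore meets b or the image of b, both
    contained in v |: b. A point of a outside v |: b would lie in some c that
    avoids v |: b. *)
Lemma swap_meets_once_sub t s A B a b u v : admissible t s -> optimal t s A B ->
  #|A| <= #|B| -> lab u = lab v -> A :&: swapF u v A = [set a] ->
  b \in A -> u \in b -> v \notin b -> a \subset v |: b.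
Proof.
move=> ts oAB cAB luv AAa bA ub vb.
have oU : optimal t s [set a] (B :|: swapF u v B).
  rewrite -AAa; apply: (optimal_uncross oAB (optimal_swap luv oAB)); rewrite ?card_swapF //.
  by rewrite AAa -card_gt0 cards1.
have [[/subsetP At /subsetP Bs _ _ AB] _] := oAB.
apply/subsetP=> w wa; apply: contraT => wZ.
have lt_Z i : s i <= #|fiber i :\: (v |: b)|.
  rewrite card_fiberD setIUl.
  have := leq_of_leqif (leq_card_setU ([set v] :&: fiber i) (b :&: fiber i)).
  have := subset_leq_card (subsetIl [set v] (fiber i)).
  by rewrite cards1 (layerP _ _ (At _ bA)); case: (ts i); lia.
have sw : 0 < s (lab w) by case: (ts (lab w)); lia.
have [c cs [cZ wc]] := layer_avoiding_through lt_Z sw wZ.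
have cb : c :&: b = set0.
  by apply/eqP; rewrite -subset0 -cZ setIS // subsetUr.
have cb' : c :&: swap u v b = set0.
  apply/eqP; rewrite -subset0 -cZ setIS //; apply/subsetP=> x; rewrite !inE.
  by case: tpermP => [->|->|_ _ ->]; rewrite ?ub ?orbT ?eqxx.
have : c \in B :|: swapF u v B.
  apply: (optimal_star_full oU cs); apply/set0Pn; exists w; by rewrite inE wc.
rewrite inE mem_swapF => /orP[] /(AB _ _ bA); first by rewrite setIC cb eqxx.
by rewrite -swap_setI0 setIC cb' eqxx.
Qed.

(** The exchange fixes a and moves b, so exactly one of u, v is in b. The other
    one must be the only point of a that b lacks. *)
Lemma swap_meets_once_exchange t s A B a b u v : admissible t s -> optimal t s A B ->
  #|A| <= #|B| -> lab u = lab v -> A :&: swapF u v A = [set a] -> b \in A -> b != a ->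
  exists w z, [/\ w \in [set u; v], z \in fiber (lab u) :\: a, z \in b & b = swap w z a].
Proof.
move=> ts oAB cAB luv AAa bA nba.
have [[/subsetP At _ _ _ _] _] := oAB.
have : a \in A :&: swapF u v A by rewrite AAa inE.
rewrite inE mem_swapF => /andP[aA aA'].
have fixa : swap u v a = a by apply/set1P; rewrite -AAa inE aA' mem_swapF swapK.
have uva : (u \in a) = (v \in a) by rewrite -{1}fixa mem_swap tpermL.
have nuv : (u \in b) != (v \in b).
  apply: contra nba => /eqP uvb; apply/eqP/set1P.
  by rewrite -AAa inE bA mem_swapF swap_id.
wlog ub : u v luv AAa uva nuv {fixa aA'} / u \in b.
  move=> wl; case ub: (u \in b); first exact: wl.
  have vb : v \in b by move: nuv; rewrite ub; case: (v \in b).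
  have AAa' : A :&: swapF v u A = [set a].
    by rewrite -AAa; congr (_ :&: _); apply/setP=> d; rewrite !mem_swapF swapC.
  have nvu : (v \in b) != (u \in b) by rewrite eq_sym.
  have [w [z [wvu zi zb eb]]] := wl v u (esym luv) AAa' (esym uva) nvu vb.
  by exists w, z; rewrite luv setUC.
have vb : v \notin b by move: nuv; rewrite ub; case: (v \in b).
have sub := swap_meets_once_sub ts oAB cAB luv AAa bA ub vb.
have va : v \in a.
  apply: contraNT nba => va; rewrite eq_sym; apply/eqP/(layer_subset_eq (At _ aA) (At _ bA)).
  apply/subsetP=> x xa; have := subsetP sub _ xa; rewrite !inE => /orP[/eqP ex|//].
  by rewrite -ex xa in va.
have [z] : exists z, z \in (b :&: fiber (lab u)) :\: a.
  apply/set0Pn; rewrite setD_eq0; apply: contra vb => subi.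
  have : v \in b :&: fiber (lab u).
    suff -> : b :&: fiber (lab u) = a :&: fiber (lab u) by rewrite !inE va luv eqxx.
    apply/eqP; rewrite eqEcard subsetI subi subsetIr /=.
    by rewrite (layerP _ _ (At _ aA)) (layerP _ _ (At _ bA)).
  by rewrite inE => /andP[].
rewrite !inE => /and3P[za zb /eqP lz].
exists v, z; split; rewrite ?inE ?za ?lz ?eqxx ?orbT //.
apply: esym; apply: (@layer_subset_eq t); rewrite ?swap_layer ?At ?lz //.
apply/subsetP=> x; rewrite mem_swap; case: tpermP => [->|->//|/eqP nv _ xa].
  by rewrite (negbTE za).
by have := subsetP sub _ xa; rewrite !inE (negbTE nv).
Qed.

(** Inclusion-exclusion: the sets that avoid b but meet a number at least
    'C(m - 1, s i - 1) >= m - 1 in the i-th part, where m = n i - t i >= 3, times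
    a factor at least 3 from another part; and 3 (m - 1) > m. *)
Lemma card_missed_pair t s a b i : admissible t s -> 1 < #|I| ->
  a \in layer t -> b \in layer t -> b :&: fiber i != a :&: fiber i ->
  deg t s + (n i - t i) < #|missed s [set a; b]|.
Proof.
move=> ts I2 at_ bt nab.
pose N d := [set c in layer s | c :&: d == set0].
have inN d c : (c \in N d) = (c \in layer s) && (c :&: d == set0).
  by rewrite [LHS]in_set.
have cN d : d \in layer t -> #|N d| = deg t s by exact: card_layer_disjoint.
have -> : missed s [set a; b] = N a :|: N b.
  apply/setP=> c; apply/missedP/idP => [[cs [d]]|].
    by rewrite in_setU !inN cs => /set2P[] -> ->; rewrite eqxx ?orbT.
  rewrite in_setU !inN -andb_orr => /andP[cs].
  by case/orP=> /eqP cd; split=> //; [exists a | exists b] => //; rewrite !inE eqxx ?orbT.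
have cU := cardsUI (N a) (N b); rewrite !cN // in cU.
set D' := \prod_(j | j != i) 'C(n j - t j, s j).
have degE : deg t s = 'C(n i - t i, s i) * D' by rewrite (bigD1 i).
have cI : #|N a :&: N b| <= 'C((n i - t i).-1, s i) * D'.
  have -> : N a :&: N b = [set c in layer s | c :&: (a :|: b) == set0].
    apply/setP=> c; rewrite in_setI !inN setIUr setU_eq0.
    by case: (c \in layer s).
  have sub j : t j <= #|(a :|: b) :&: fiber j|.
    by rewrite -(layerP _ _ at_ j) subset_leq_card // setSI // subsetUl.
  rewrite card_layer_avoiding (bigD1 i) //= leq_mul //; last first.
    by apply: leq_prod => j _; rewrite leq_bin2l // card_fiberD leq_sub2l.
  rewrite leq_bin2l // card_fiberD.
  suff : t i < #|(a :|: b) :&: fiber i| by lia.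
  rewrite -(layerP _ _ at_ i) proper_card // properEneq setSI ?subsetUl // andbT.
  apply: contra nab => /eqP e; rewrite eqEcard (layerP _ _ at_) (layerP _ _ bt) leqnn.
  by rewrite andbT e setSI ?subsetUr.
have D3 : 3 <= D'.
  case/card_gt1P: I2 => j1 [j2 [_ _ nj]].
  have [j ji] : exists j, j != i.
    by have [e|] := eqVneq j1 i; [exists j2; rewrite -e eq_sym | exists j1].
  have := prod_avoid_ge (P := fun j => j != i) ts ji.
  by rewrite -/D'; case: (ts j); lia.
have [? ? ? ? ?] := ts i.
have m3 : 2 < n i - t i by lia.
have : (n i - t i).-1 <= 'C((n i - t i).-1, (s i).-1).
  by apply: leq_bin_self; lia.
have bS : 'C(n i - t i, s i) =
   'C((n i - t i).-1, s i) + 'C((n i - t i).-1, (s i).-1).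
  by apply: bin_pascal; lia.
rewrite bS mulnDl in degE; move: cI degE cU D3 m3.
set C1 := 'C(_, s i); set C2 := 'C(_, (s i).-1) => cI degE cU D3 m3 C2m.
have := leq_mul C2m D3; lia.
Qed.

(** A and its image, with a removed, are disjoint subfamilies of the at most
    2 (n i - t i) sets obtained from a by replacing u or v, whence
    |A| <= n i - t i + 1. Maximality then leaves too little room for the sets
    missed by two members of A. *)
Lemma swap_not_meets_once t s A B a u v : admissible t s -> 1 < #|I| ->
  optimal t s A B -> #|A| <= #|B| -> 1 < #|A| -> lab u = lab v ->
  A :&: swapF u v A <> [set a].
Proof.
move=> ts I2 oAB cAB A2 luv AAa; have [[/subsetP At _ _ _ _] _] := oAB.
have aA : a \in A by have := set11 a; rewrite -AAa inE => /andP[].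
have exch := swap_meets_once_exchange ts oAB cAB luv AAa.
set i := lab u in exch.
have exch' b : b \in swapF u v A -> b != a -> exists w z,
    [/\ w \in [set u; v], z \in fiber i :\: a, z \in b & b = swap w z a].
  apply: (swap_meets_once_exchange ts (optimal_swap luv oAB) _ luv).
    by rewrite !card_swapF.
  by rewrite swapFK setIC.
have sub_exch (F : {set {set T}}) : (forall b, b \in F -> b != a ->
    exists w z, [/\ w \in [set u; v], z \in fiber i :\: a, z \in b & b = swap w z a]) ->
  F :\ a \subset [set swap u z a | z in fiber i :\: a] :|: [set swap v z a | z in fiber i :\: a].
  move=> eF; apply/subsetP=> b; rewrite in_setD1 => /andP[ba bF].
  have [w [z [wuv zi _ ->]]] := eF b bF ba; rewrite in_setU.
  by case/set2P: wuv => ->; apply/orP; [left | right]; apply/imsetP; exists z.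
have subA := sub_exch _ exch; have subA' := sub_exch _ exch'.
have cA : #|A| <= (n i - t i).+1.
  have dis : (A :\ a) :&: (swapF u v A :\ a) = set0.
    by rewrite -setDIl AAa setDv.
  have cU := cardsUI (A :\ a) (swapF u v A :\ a).
  have : #|(A :\ a) :|: (swapF u v A :\ a)| <= 2 * (n i - t i).
    apply: leq_trans (subset_leq_card (introT subUsetP (conj subA subA'))) _.
    apply: leq_trans (leq_card_setU _ _) _; rewrite mul2n -addnn.
    by rewrite -(layerP _ _ (At _ aA)) -card_fiberD leq_add // leq_imset_card.
  have aA' : a \in swapF u v A by have := set11 a; rewrite -AAa inE => /andP[].
  have := cardsD1 a A; have := cardsD1 a (swapF u v A).
  rewrite aA aA' card_swapF; move: cU; rewrite dis cards0 /=.
  move: (n i - t i) => m; move: #|_ :|: _| #|A :\ a| #|swapF u v A :\ a| #|A| => p q r l. lia.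
have [b] : exists b, b \in A :\ a.
  by apply/card_gt0P; move: A2; rewrite (cardsD1 a A) aA ltnS.
rewrite in_setD1 => /andP[ba bA]; have [w [z [_ zi zb _]]] := exch b bA ba.
have lt_pair : deg t s + (n i - t i) < #|missed s [set a; b]|.
  apply: (card_missed_pair ts I2 (At _ aA) (At _ bA)).
  apply: contraTneq zi => /setP/(_ z); rewrite in_setD !in_setI zb.
  by case: (z \in fiber i); rewrite ?andbT ?andbF // => <-.
have : #|missed s [set a; b]| <= #|missed s A|.
  apply/subset_leq_card/subsetP=> c /missedP[cs [d dab cd]].
  apply/missedP; split=> //; exists d => //.
  by case/set2P: dab => ->.
have := card_missed oAB.1; have := optimal_ge_star oAB; move: cA lt_pair.
move: (deg t s) #|layer s| #|missed s A| #|missed s [set a; b]| #|A| #|B| (n i - t i).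
lia.
Qed.

(** Induction on |A|: if A meets its image in a proper non-empty part, uncrossing
    yields an optimal pair with a smaller first family, which has one member by
    induction, and [swap_not_meets_once] excludes this. Otherwise A is a block. *)
Lemma optimal_smaller_single t s A B : admissible t s -> 1 < #|I| ->
  (forall i j, i != j -> 4 * n i <= 7 * n j) ->
  optimal t s A B -> #|A| <= #|B| -> #|A| = 1.
Proof.
move=> ts I2 ratio; have [m] := ubnP #|A|; elim: m A B => // m IH A B Am oAB cAB.
have A0 : 0 < #|A| by rewrite card_gt0; case: oAB => -[].
apply/eqP; rewrite eqn_leq A0 andbT leqNgt; apply/negP=> A2.
have [i0 _] : exists i : I, i \in I by apply/card_gt0P; apply: ltnW I2.
apply: (block_contradiction ts i0 ratio oAB A2) => u v luv.
have [AA0 | AA0] := eqVneq (A :&: swapF u v A) set0; [by right | left].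
have oU : optimal t s (A :&: swapF u v A) (B :|: swapF u v B).
  by apply: (optimal_uncross oAB (optimal_swap luv oAB)); rewrite ?card_swapF.
have sAA : A :&: swapF u v A \subset A := subsetIl _ _.
have [lt_m | ge_m] := ltnP #|A :&: swapF u v A| #|A|.
  have : #|A :&: swapF u v A| = 1.
    apply: (IH _ _ _ oU); first exact: leq_trans lt_m _.
    apply: leq_trans (ltnW lt_m) (leq_trans cAB _).
    by rewrite subset_leq_card // subsetUl.
  by move/eqP/cards1P=> [a /(swap_not_meets_once ts I2 oAB cAB A2 luv)].
have AA : A :&: swapF u v A = A by apply/eqP; rewrite eqEcard sAA.
by apply/esym/eqP; rewrite eqEcard card_swapF leqnn andbT; apply/setIidPl.
Qed.

(** * The maximum and the extremal pairs *)
Local Notation star s a := [set c in layer s | c :&: a != set0].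

Lemma exists_optimal t s A B : crossing t s A B -> exists A' B', optimal t s A' B'.
Proof.
pose crossingb (F : {set {set T}} * {set {set T}}) :=
  [&& F.1 \subset layer t, F.2 \subset layer s, F.1 != set0, F.2 != set0
    & [forall a in F.1, forall b in F.2, a :&: b != set0]].
have crossingP A1 B1 : reflect (crossing t s A1 B1) (crossingb (A1, B1)).
  apply: (iffP and5P) => -[? ? ? ? cr]; split=> //.
    by move=> a b aA bB; move/forall_inP/(_ a aA)/forall_inP/(_ b bB): cr.
  by apply/forall_inP=> a aA; apply/forall_inP=> b bB; apply: cr.
move/crossingP=> AB.
have [[A' B'] /crossingP AB' max] :=
  arg_maxnP (fun F : {set {set T}} * {set {set T}} => #|F.1| + #|F.2|) AB.
by exists A', B'; split=> // A1 B1 /crossingP/max.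
Qed.

Lemma optimal_singleE t s a B : optimal t s [set a] B ->
  a \in layer t /\ B = star s a.
Proof.
move=> oaB; have [[at_ /subsetP Bs _ _ aB] _] := oaB.
split; first by rewrite sub1set in at_.
apply/setP=> c; apply/idP/setIdP => [cB | [cs ca]]; last exact: optimal_star_full oaB cs ca.
by rewrite Bs // setIC aB ?inE.
Qed.

Lemma crossing_deg_lt t s A B : crossing t s A B -> deg t s < #|layer s|.
Proof.
case=> /subsetP At /subsetP Bs /set0Pn[a aA] /set0Pn[b bB] AB.
rewrite card_layer -(card_layer_meeting s (At _ aA)) -[X in X < _]add0n ltn_add2r.
by apply/card_gt0P; exists b; rewrite inE Bs // setIC AB.
Qed.

(** When the single family is on the side of the larger layer s, the value of
    the pair is |layer t| - deg s t + 1; it reaches |layer s| - deg t s + 1 only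
    if the layers have the same size, because
    deg t s * |layer t| = deg s t * |layer s|. *)
Lemma optimal_star_or_costar t s A B : admissible t s -> 1 < #|I| ->
  (forall i j, i != j -> 4 * n i <= 7 * n j) -> #|layer t| <= #|layer s| ->
  optimal t s A B ->
  (exists2 a, a \in layer t & A = [set a] /\ B = star s a) \/
  (#|layer s| = #|layer t| /\
   exists2 b, b \in layer s & B = [set b] /\ A = star t b).
Proof.
move=> ts I2 ratio xy oAB; have [cAB | /ltnW cBA] := leqP #|A| #|B|.
  left; have /eqP/cards1P[a Aa] := optimal_smaller_single ts I2 ratio oAB cAB.
  by rewrite Aa in oAB *; have [at_ ->] := optimal_singleE oAB; exists a.
right; have oBA := optimalC oAB.
have B1 := optimal_smaller_single (admissibleC ts) I2 ratio oBA cBA.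
have /eqP/cards1P[b Bb] := B1.
rewrite Bb in oBA; have [bs eA] := optimal_singleE oBA.
split; last by exists b.
have := card_layer_meeting t bs; rewrite -eA -card_layer.
have := optimal_ge_star oAB; have := crossing_deg_lt oAB.1.
move: (deg_double_count ts) xy; rewrite B1.
move: (deg t s) (deg s t) #|layer t| #|layer s| #|A| => d e x y k dd xy dy low eq.
apply/eqP; rewrite eqn_leq xy andbT -(@leq_pmul2l (y - d)) ?subn_gt0 //.
by rewrite !mulnBl dd; nia.
Qed.

Lemma star_card t s a : a \in layer t -> 
  #|[set a]| + #|star s a| = #|layer s| - deg t s + 1.
Proof.
move=> at_; have := card_layer_meeting s at_.
by rewrite -card_layer cards1 => <-; rewrite addnK addnC.
Qed.

Lemma optimal_card t s A B : admissible t s -> 1 < #|I| ->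
  (forall i j, i != j -> 4 * n i <= 7 * n j) -> #|layer t| <= #|layer s| ->
  optimal t s A B -> #|A| + #|B| = #|layer s| - deg t s + 1.
Proof.
move=> ts I2 ratio xy oAB; 
case: (optimal_star_or_costar ts I2 ratio xy oAB).
  by case=> a at_ [-> ->]; apply: star_card.
case=> exy [b bs [-> ->]]; rewrite addnC (star_card t bs) exy.
have /eqP := deg_double_count ts.
by rewrite exy eqn_pmul2r ?(layer_gt0 ts) // => /eqP ->.
Qed.

End LabelledGroundSet.

(** * Disjoint unions of intervals *)
Lemma card_fiber_tag (p : nat) (n : 'I_p -> nat) (i : 'I_p) :
  #|fiber (@tag _ (fun j => 'I_(n j))) i| = n i.
Proof.
have Tinj : injective (Tagged (i := i) (fun j => 'I_(n j))).
  by move=> x y /eqP; rewrite eq_Tagged => /eqP.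
rewrite -[RHS]card_ord -(card_imset predT Tinj); apply: eq_card => w; rewrite inE.
apply/eqP/imsetP => [<-|[x _ ->]] //.
by case: w => j x; exists x.
Qed.

Lemma multipart_familyE (p : nat) (n k : 'I_p -> nat) :
  multipart_family n k = layer (@tag _ (fun j => 'I_(n j))) k.
Proof.
apply/setP=> A; rewrite [LHS]inE [RHS]inE; apply: eq_forallb => i; congr (_ == _).
have Tinj : injective (Tagged (i := i) (fun j => 'I_(n j))).
  by move=> x y /eqP; rewrite eq_Tagged => /eqP.
rewrite -(card_imset _ Tinj); apply: eq_card => w; rewrite inE.
apply/imsetP/andP => [[x + ->]|]; first by rewrite !inE.
rewrite !inE; case: w => j x [wA /eqP /= ji]; move: x wA; rewrite ji => x wA.
by exists x; rewrite ?inE.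
Qed.

Theorem theorem1p6 (p : nat) (n t s : 'I_p -> nat)
  (FA FB : {set {set ground n}})
  (hp : 2 <= p)
  (hpos : forall i, [/\ 0 < n i, 0 < t i & 0 < s i])
  (hn : forall i, s i + t i + 1 <= n i)
  (hs : forall i, 2 <= s i /\ 2 * s i <= n i)
  (ht : forall i, 2 <= t i /\ 2 * t i <= n i)
  (hratio : forall i j, i != j -> 4 * n i <= 7 * n j)
  (hprod : \prod_(i < p) 'C(n i, t i) <= \prod_(i < p) 'C(n i, s i))
  (hFA : FA \subset multipart_family n t)
  (hFB : FB \subset multipart_family n s)
  (hFA0 : FA != set0)
  (hFB0 : FB != set0)
  (hcross : cross_intersecting FA FB) :
  let bound :=
    \prod_(i < p) 'C(n i, s i) - \prod_(i < p) 'C(n i - t i, s i) + 1 in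
  #|FA| + #|FB| <= bound /\
  (#|FA| + #|FB| = bound <->
     (\prod_(i < p) 'C(n i, t i) <= \prod_(i < p) 'C(n i, s i) /\
      exists2 A : {set ground n}, A \in multipart_family n t &
        FA = [set A] /\
        FB = [set B in multipart_family n s | B :&: A != set0])
     \/
     (\prod_(i < p) 'C(n i, s i) = \prod_(i < p) 'C(n i, t i) /\
      exists2 B : {set ground n}, B \in multipart_family n s &
        FB = [set B] /\
        FA = [set A in multipart_family n t | B :&: A != set0])).
Proof.
move=> bound.
set lab := @tag 'I_p (fun i => 'I_(n i)).
have nE i : #|fiber lab i| = n i := card_fiber_tag n i.
have ts : admissible lab t s.
  move=> i; rewrite nE; have [? ?] := hs i; have [? ?] := ht i.
  by split=> //; have := hn i; lia.
have I2 : 1 < #|'I_p| by rewrite card_ord.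
have ratio i j : i != j -> 4 * #|fiber lab i| <= 7 * #|fiber lab j|.
  by rewrite !nE; apply: hratio.
have layerE k : #|layer lab k| = \prod_(i < p) 'C(n i, k i).
  by rewrite card_layer; apply: eq_bigr => i _; rewrite nE.
have xy : #|layer lab t| <= #|layer lab s| by rewrite !layerE.
have boundE : bound =
    #|layer lab s| - \prod_i 'C(#|fiber lab i| - t i, s i) + 1.
  by rewrite layerE; congr (_ - _ + _); apply: eq_bigr => i _; rewrite nE.
rewrite !multipart_familyE -!layerE in hFA hFB *.
have cross : crossing lab t s FA FB by split.
have [A0 [B0 oAB0]] := exists_optimal cross.
have max : forall A B, crossing lab t s A B -> #|A| + #|B| <= bound.
  by move=> A B /oAB0.2; rewrite (optimal_card ts I2 ratio xy oAB0) boundE.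
split; first exact: max.
have costarE B : [set A in layer lab t | B :&: A != set0] =
                 [set A in layer lab t | A :&: B != set0].
  by apply/setP=> A; rewrite !in_set setIC.
split=> [eM | [[_ [A At [-> ->]]] | [exy [B Bs [-> ->]]]]]; last 2 first.
- by rewrite boundE; apply: star_card.
- rewrite costarE addnC (star_card t Bs) boundE exy.
  have /eqP := deg_double_count ts.
  by rewrite exy eqn_pmul2r ?(layer_gt0 ts) // => /eqP ->.
have oFAB : optimal lab t s FA FB by split=> // A B /max; rewrite eM.
case: (optimal_star_or_costar ts I2 ratio xy oFAB) => [[A At eAB] | [exy [B Bs eBA]]].
  by left; split=> //; exists A.
by right; split=> //; exists B; rewrite // costarE.
Qed.
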